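(* Suppose (W), (G) and (N) of the context hold, and let the stepsize $\alpha>0$ and the general stepsizes $\gamma_k>0$ and noise factors $\beta_k>0$ be given. Given any finite number of iterations $K$, the algorithm described in the context is $\epsilon$-differentially private for a given $\epsilon>0$ if the Laplace noise parameters $b_\eta$ and $b_\xi$ satisfy $$2\sqrt r\,C\sum_{k=1}^{K}\sum_{t=0}^{k-1}\left(\frac{w_{ii}^{\,k-1-t}}{\beta_k b_\eta}+\frac{\alpha|c_{k,t}|}{\beta_k b_\xi}\right)\gamma_t\le\epsilon$$ for all $i\in\{1,\dots,n\}$, where $$c_{k,t}:=w_{ii}^{\,k-2-t}\big((k-t-1)-(k-t)w_{ii}\big).$$
   Context: Setting: $n$ agents. A distributed optimization problem $\mathcal{P}=(\mathcal{X},f,\mathcal{G}_W)$ consists of a domain $\mathcal{X}\subseteq\mathbb{R}^r$, an objective $f=\frac1n\sum_{i=1}^nf_i$ with differentiable local objectives $f_i:\mathbb{R}^r\to\mathbb{R}$, and an undirected communication graph $\mathcal{G}_W$ induced by a weight matrix $W$. (W) $W=[w_{ij}]\in\mathbb{R}^{n\times n}$ is entrywise nonnegative, doubly stochastic and symmetric, $w_{ii}>0$ for all $i$, and the undirected graph on $\{1,\dots,n\}$ with an edge between $i$ and $j$ whenever $w_{ij}>0$ is connected. (G) The gradients of all local objective functions are bounded on $\mathcal{X}$: there is $C>0$ such that $\|\nabla f_i(x)\|_2\le C$ for every $x\in\mathcal{X}$ and every local objective $f_i$ in the set $\mathcal{S}$ of admissible local objective functions. (N) The noises $\eta_{ij,k}\sim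 Lap(b_\eta)$ and $\xi_{ij,k}\sim Lap(b_\xi)$ are independent along iterations $k$, across agents $i$, and across state dimensions $j=1,\dots,r$, where $Lap(b)$ has density $\frac1{2b}e^{-|x|/b}$ on $\mathbb{R}$ (so they have zero mean and bounded variance). Write $\eta_{i,k},\xi_{i,k}\in\mathbb{R}^r$ for the corresponding vectors. Algorithm: starting from an initial state $\boldsymbol{x}(0)=\{(s_{i,0})_i,(x_{i,0})_i\}$ with arbitrary $s_{i,0},x_{i,0}\in\mathcal X$, each agent $i$ updates $$s_{i,k+1}=w_{ii}s_{i,k}+\sum_{j\ne i}w_{ij}(s_{j,k}+\beta_k\eta_{j,k})+\gamma_k\nabla f_i(x_{i,k}),$$ $$x_{i,k+1}=w_{ii}x_{i,k}+\sum_{j\ne i}w_{ij}(x_{j,k}+\beta_k\xi_{j,k})-\alpha(s_{i,k+1}-s_{i,k}).$$ The observation sequence is $\mathcal{O}=\{\boldsymbol m_0,\boldsymbol n_0,\boldsymbol m_1,\boldsymbol n_1,\dots\}$ (over iterations $k=0,\dots,K$), where $\boldsymbol m_k=(s_{i,k}+\beta_k\eta_{i,k})_{i=1}^n$ and $\boldsymbol n_k=(x_{i,k}+\beta_k\xi_{i,k})_{i=1}^n$. $Alg(\mathcal{P},\boldsymbol{x}(0))$ denotes the random observation sequence generated for problem $\mathcal{P}$ from $\boldsymbol{x}(0)$, and $\mathbb{O}$ the set of all possible observation sequences. Adjacency: $\mathcal{P}$ and $\mathcal{P}'$ are adjacent if $\mathcal{X}=\mathcal{X}'$, $\mathcal{G}_W=\mathcal{G}_W'$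 (same weights $W$), and there is an $i$ with $f_i\ne f_i'$ and $f_j=f_j'$ for all $j\ne i$. $\epsilon$-differential privacy: for any two adjacent problems $\mathcal{P},\mathcal{P}'$, any set of observation sequences $\mathbb{Y}\subseteq\mathbb{O}$ and any initial state $\boldsymbol{x}(0)$, $\mathbb{P}(Alg(\mathcal{P},\boldsymbol{x}(0))\in\mathbb{Y})\le e^{\epsilon}\,\mathbb{P}(Alg(\mathcal{P}',\boldsymbol{x}(0))\in\mathbb{Y})$, the probability being over the randomness of the iteration process.
   Formalization: Added assumption: for every problem and initial state, almost surely the decisions x_{i,k} with k<K lie in X (automatic if X is all of R^r). Without it the claim fails, e.g. X={0}, local objectives 0 and x^4, n=2, K=2. Sets of observation sequences are taken measurable. *)

(* Defs.v *)
From mathcomp Require Import all_boot all_order all_algebra.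
From mathcomp Require Import all_classical all_reals all_analysis.
Set Implicit Arguments.
Unset Strict Implicit.
Unset Printing Implicit Defensive.
Import Order.TTheory GRing.Theory Num.Theory.
Import numFieldNormedType.Exports.
Local Open Scope classical_set_scope.
Local Open Scope ring_scope.

Section Euclidean.
Context {R : realType} {r : nat}.

(* The library norm on matrices is the sup norm, so the 2-norm is spelled out. *)
Definition norm2 (v : 'rV[R]_r) : R := Num.sqrt (\sum_j v 0 j ^+ 2).

Definition gradient (f : 'rV[R]_r -> R) (x : 'rV[R]_r) : 'rV[R]_r :=
  \row_j 'D_(delta_mx 0 j) f x.

End Euclidean.

Section Noise.
Context {R : realType} {d : measure_display} {T : measurableType d}.
Variable P : probability T R.

Definition laplace_pdf (b x : R) : R := (2 * b)^-1 * expR (- `|x| / b).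

Definition laplace_distributed (b : R) (Z : {RV P >-> R}) : Prop :=
  forall A : set R, measurable A ->
    distribution P Z A = (\int[lebesgue_measure]_(x in A) (laplace_pdf b x)%:E)%E.

Definition mutually_independent (I : choiceType) (Z : I -> {RV P >-> R}) : Prop :=
  forall (J : seq I) (B : I -> set R),
    uniq J -> (forall c, measurable (B c)) ->
    P (\bigcap_(c in [set` J]) (Z c @^-1` B c)) =
    (\prod_(c <- J) P (Z c @^-1` B c))%E.

(* The two noise processes taken as one family: [inl (i, k, j)] is component j
   of eta_{i,k}, and [inr (i, k, j)] is component j of xi_{i,k}. *)
Definition joint_noise (n r : nat) (eta xi : 'I_n -> nat -> 'I_r -> {RV P >-> R})
    (c : ('I_n * nat * 'I_r) + ('I_n * nat * 'I_r)) : {RV P >-> R} :=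
  match c with
  | inl (i, k, j) => eta i k j
  | inr (i, k, j) => xi i k j
  end.

End Noise.

Section Problems.
Context {R : realType} {n r : nat}.

Record weight_matrix (W : 'M[R]_n) : Prop := WeightMatrix {
  weight_ge0 : forall i j, 0 <= W i j ;
  weight_row_sum : forall i, \sum_j W i j = 1 ;
  weight_col_sum : forall j, \sum_i W i j = 1 ;
  weight_sym : W^T = W ;
  weight_diag_gt0 : forall i, 0 < W i i ;
  weight_connected : forall i j, connect (fun a b => 0 < W a b) i j
}.

(* The global objective is (1/n) \sum_i local_obj i and the communication graph
   is the one induced by [weights]; neither is stored separately. *)
Record problem := Problem {
  domain : set 'rV[R]_r ;
  local_obj : 'I_n -> 'rV[R]_r -> R ;
  weights : 'M[R]_n
}.

Definition problem_class (X : set 'rV[R]_r) (S : set ('rV[R]_r -> R))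
    (W : 'M[R]_n) : set problem :=
  [set p | [/\ domain p = X, weights p = W & forall i, S (local_obj p i)]].

Definition adjacent_problems (p p' : problem) : Prop :=
  [/\ domain p = domain p', weights p = weights p' &
      exists i, local_obj p i <> local_obj p' i /\
        forall j, j != i -> local_obj p j = local_obj p' j].

Record state := State {
  tracker : 'I_n -> 'rV[R]_r ;   (* s_i *)
  decision : 'I_n -> 'rV[R]_r    (* x_i *)
}.

Definition initial_state (p : problem) (z : state) : Prop :=
  forall i, domain p (tracker z i) /\ domain p (decision z i).

End Problems.
Arguments problem : clear implicits.
Arguments state : clear implicits.

(* Entry k of an observation sequence is the pair (m_k, n_k).  Tuples are used
   because they carry the product sigma-algebra of the Borel sets of R; a
   notation rather than a definition lets that structure be inferred. *)
Notation observations R n r K :=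
  (K.+1.-tuple (n.-tuple (r.-tuple R) * n.-tuple (r.-tuple R))).

Section Algorithm.
Context {R : realType} {d : measure_display} {T : measurableType d}.
Context {P : probability T R} {n r : nat}.
Variables (alpha : R) (gamma beta : nat -> R).
Variables eta xi : 'I_n -> nat -> 'I_r -> {RV P >-> R}.

Definition noise_vector (Z : 'I_n -> nat -> 'I_r -> {RV P >-> R})
    (i : 'I_n) (k : nat) (w : T) : 'rV[R]_r := \row_j Z i k j w.

Definition tracker_msg (z : state R n r) (k : nat) (w : T) (i : 'I_n) : 'rV[R]_r :=
  tracker z i + beta k *: noise_vector eta i k w.

Definition decision_msg (z : state R n r) (k : nat) (w : T) (i : 'I_n) : 'rV[R]_r :=
  decision z i + beta k *: noise_vector xi i k w.

Definition next_tracker (p : problem R n r) (z : state R n r) (k : nat) (w : T)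
    (i : 'I_n) : 'rV[R]_r :=
  weights p i i *: tracker z i
  + \sum_(j | j != i) weights p i j *: tracker_msg z k w j
  + gamma k *: gradient (local_obj p i) (decision z i).

Definition next_decision (p : problem R n r) (z : state R n r) (k : nat) (w : T)
    (i : 'I_n) : 'rV[R]_r :=
  weights p i i *: decision z i
  + \sum_(j | j != i) weights p i j *: decision_msg z k w j
  - alpha *: (next_tracker p z k w i - tracker z i).

Fixpoint iterate (p : problem R n r) (z0 : state R n r) (w : T) (k : nat) :
    state R n r :=
  if k is k'.+1 then
    let z := iterate p z0 w k' in
    State (next_tracker p z k' w) (next_decision p z k' w)
  else z0.

(* The gradient step is taken at the decisions x_{i,k}.  When the domain is not
   the whole space, a bound on the gradients over the domain says something about
   the algorithm only if these points lie in it; nothing projects them back.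
   The observations up to index K involve the gradients at steps k < K only.
   For a domain equal to the whole space this property is trivial. *)
Definition decisions_in_domain (K : nat) (class : set (problem R n r)) : Prop :=
  forall p, class p -> forall z0, initial_state p z0 ->
  forall i k, (k < K)%N ->
    {ae P, forall w, domain p (decision (iterate p z0 w k) i)}.

Definition alg (K : nat) (p : problem R n r) (z0 : state R n r) (w : T) :
    observations R n r K :=
  [tuple ([tuple [tuple tracker_msg (iterate p z0 w k) k w i 0 j | j < r] | i < n],
          [tuple [tuple decision_msg (iterate p z0 w k) k w i 0 j | j < r] | i < n])
  | k < K.+1].

End Algorithm.

Section Privacy.
Context {R : realType} {d : measure_display} {T : measurableType d}.
Context {n r K : nat}.
Variable P : probability T R.

Definition differentially_private (class : set (problem R n r))
    (A : problem R n r -> state R n r -> T -> observations R n r K) (eps : R) : Prop :=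
  forall p p', class p -> class p' -> adjacent_problems p p' ->
  forall z0, initial_state p z0 ->
  forall Y : set (observations R n r K),
    measurable Y ->
    (P (A p z0 @^-1` Y) <= (expR eps)%:E * P (A p' z0 @^-1` Y))%E.

End Privacy.

(* The exponent k - 2 - t is an integer: it equals -1 when t = k - 1. *)
Definition sens_coef {R : realType} (w : R) (k t : nat) : R :=
  w ^ (k%:Z - 2 - t%:Z) * ((k%:R - t%:R - 1) - (k%:R - t%:R) * w).

(* Main.v *)
Require Import Defs.
From HB Require Import structures.
From mathcomp Require Import all_boot all_order all_algebra.
From mathcomp Require Import all_classical all_reals all_analysis.
From mathcomp Require Import measurable_realfun.
From mathcomp Require Import ring lra zify.
Import Order.TTheory GRing.Theory Num.Theory.
Import numFieldNormedType.Exports.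
Local Open Scope classical_set_scope.
Local Open Scope ring_scope.

(** The observations determine the trajectory: given the broadcast messages and
the initial state, every agent's state follows by replaying its own update
([replay]).  So fix the observations produced by problem [p] on a noise
realisation [x], and ask which noise would make [p'] produce the very same
observations.  It is [x] moved by the difference of the two replayed states
divided by [beta k] ([noise_shift]); call this move tau.  Then
Alg(p)(x) = Alg(p')(tau x) ([observed_sheared]), and the theorem becomes the
statement that tau distorts the law of the noise by a factor at most
[expR eps].

Two facts give this bound.

Probability.  The shift of a noise coordinate of time [k] depends on noise of
times before [k] only, so tau is a triangular shear.  Composing
one-coordinate shifts from the last time to the first, and using that moving a
Laplace(b) variable by an amount [h] independent of it costs a density factor
[expR (`|h| / b)], one gets for every nonnegative [F]
  E[F(tau N) exp(- sum_c |h_c(N)| / b_c)] <= E[F(N)]     ([integral_shear]).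
Keeping the exponential under the expectation matters: the stated budget bounds
the sum of the [|h_c| / b_c] at each realisation, whereas the sum of the suprema
of its terms may be larger (the euclidean gradient bound controls the sum over
the dimensions, not each dimension at its own worst case).

Sensitivity.  Only the agent [i0] at which the problems differ has a nonzero
state difference.  Its two components satisfy linear recurrences driven by the
gradient differences g_t, with solutions
  sum_t w^(k-1-t) gamma_t g_t   and   alpha sum_t c_(k,t) gamma_t g_t
([tracker_gapE], [decision_gapE]); the 1-norm of g_t is at most
2 sqrt(r) C, which turns the privacy budget into a bound on the total cost
([sum_norm1_gaps_le]).

The gradient bound must hold for [p'] along the states replayed from the
observations of [p], that is, along the run of [p'] on the noise tau N, while
the domain condition concerns the run of [p'] on N.  Since the domain may fail
to be measurable one works with the set of noises on which the gradients are
bounded by C.  It is measurable (gradients of differentiable functions are Borel,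
[measurable_gradient_comp]) and has probability one for N; the shear inequality
makes the law of tau N absolutely continuous with respect to that of N
([shear_null]), so the set has probability one for tau N as well. *)

(** * The Laplace law under translation *)

Section LaplaceShift.
Context {R : realType}.
Implicit Types (b h x : R) (A : set (measurableTypeR R)).
Notation mu := (@lebesgue_measure R).

Lemma measurable_shift h : measurable_fun [set: R] (fun x : R => x + h).
Proof. by apply: measurable_funD. Qed.

Lemma lebesgue_measure_shift h A : measurable A ->
  pushforward mu (fun x : R => (x + h : measurableTypeR R)) A = mu A.
Proof.
move=> mA; apply/esym/lebesgue_measure_unique => //=; first exact: measurable_shift.
move=> _ _ [[a c]] _ <-; rewrite /pushforward.
rewrite (_ : _ @^-1` _ = `]a - h, c - h]%classic).
  rewrite !lebesgue_measure_itv/= !lte_fin ltrD2r -!EFinB.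
  by congr (if _ then _ else _); congr EFin; ring.
by apply/seteqP; split => x /=; rewrite !in_itv/= ltrBlDr lerBrDr.
Qed.

Lemma laplace_pdf_ge0 b x : 0 < b -> 0 <= laplace_pdf b x.
Proof.
by move=> b0; rewrite /laplace_pdf mulr_ge0 ?expR_ge0// invr_ge0 mulr_ge0// ltW.
Qed.

Lemma measurable_laplace_pdf b : measurable_fun [set: R] (laplace_pdf b).
Proof.
apply: measurable_funM => //; apply: measurableT_comp => //.
apply: measurable_funM => //; apply: measurableT_comp => //.
Qed.

(** The triangle inequality in the exponent. *)
Lemma laplace_pdf_shift b h x : 0 < b ->
  laplace_pdf b x <= expR (`|h| / b) * laplace_pdf b (x + h).
Proof.
move=> b0; rewrite /laplace_pdf mulrCA ler_pM2l ?invr_gt0 ?mulr_gt0//.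
rewrite -expRD ler_expR -mulrDl ler_pM2r ?invr_gt0//.
by have := ler_normD x h; lra.
Qed.


Context (nu : {measure set R -> \bar R}) (b : R).
Hypothesis b0 : 0 < b.
Hypothesis nuE : forall A : set R, measurable A ->
  nu A = (\int[mu]_(x in A) (laplace_pdf b x)%:E)%E.

Lemma laplace_measure_shift h (A : set R) : measurable A ->
  (nu ((fun x : R => x + h)%R @^-1` A) <= (expR (`|h| / b))%:E * nu A)%E.
Proof.
move=> mA.
have mp : measurable_fun A (fun x : R => (laplace_pdf b x)%:E).
  by apply/measurable_funTS/measurable_EFinP; exact: measurable_laplace_pdf.
have mphi : measurable_fun [set: measurableTypeR R]
    (fun x : measurableTypeR R => x + h : measurableTypeR R).
  exact: measurable_shift.
have mA' : measurable ((fun x : R => x + h) @^-1` A).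
  by rewrite -[X in measurable X]setTI; exact: mphi.
rewrite !nuE//.
have -> : (\int[mu]_(x in A) (laplace_pdf b x)%:E =
   \int[mu]_(x in (fun x : R => x + h)%R @^-1` A) (laplace_pdf b (x + h)%R)%:E)%E.
  have <- := ge0_integral_pushforward mphi mu mA mp.
    by apply: eq_measure_integral => //= B mB BA; exact/esym/lebesgue_measure_shift.
  by move=> x _; rewrite lee_fin laplace_pdf_ge0.
rewrite -ge0_integralZl//=; last 2 first.
- apply/measurable_funTS/measurable_EFinP.
  by apply: (measurableT_comp (measurable_laplace_pdf b)).
- by move=> x _; rewrite lee_fin laplace_pdf_ge0.
apply: ge0_le_integral => //=.
- by move=> x _; rewrite lee_fin laplace_pdf_ge0.
- by apply/measurable_funTS/measurable_EFinP; exact: measurable_laplace_pdf.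
- apply/measurable_funTS/measurable_EFinP/measurable_funM => //.
  by apply: (measurableT_comp (measurable_laplace_pdf b)).
- by move=> x _; rewrite lee_fin laplace_pdf_shift.
Qed.

(** Integral form of the set-wise comparison, as needed after conditioning on the
other noise coordinates. *)
Lemma laplace_integral_shift h (F : R -> \bar R) :
  measurable_fun setT F -> (forall x, 0 <= F x)%E ->
  (\int[nu]_x F (x + h)%R <= (expR (`|h| / b))%:E * \int[nu]_x F x)%E.
Proof.
move=> mF F0; have mphi := measurable_shift h.
have := ge0_integral_pushforward mphi nu measurableT mF (fun x _ => F0 x).
rewrite preimage_setT => <-.
have c0 : 0 <= expR (`|h| / b) by exact: expR_ge0.
rewrite -[c in (c%:E * _)%E]/(NngNum c0)%:num.
rewrite -ge0_integral_mscale//.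
apply: ge0_le_measure_integral => //= A mA.
by rewrite /pushforward /mscale/=; exact: laplace_measure_shift.
Qed.

End LaplaceShift.

(** * Triangular shears of independent Laplace noise *)

Section Boxes.
Context d (T : measurableType d) (n : nat).

Definition box (B : 'I_n -> set T) : set (n.-tuple T) :=
  [set x | forall i, B i (tnth x i)].

Definition measurable_boxes : set (set (n.-tuple T)) :=
  [set A | exists2 B, forall i, measurable (B i) & A = box B].

Lemma measurable_box B : (forall i, measurable (B i)) -> measurable (box B).
Proof.
move=> mB; rewrite (_ : box B = \bigcap_(i in [set` 'I_n]) (@tnth _ T ^~ i @^-1` B i)).
  apply: fin_bigcap_measurable => // i _.
  by rewrite -[X in measurable X]setTI; exact: measurable_tnth.
by apply/seteqP; split=> [x Bx i _|x Bx i]; apply: Bx.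
Qed.

(** Boxes form a pi-system generating the product sigma-algebra, so independence
needs to be checked on boxes only. *)
Lemma measurable_tuple_boxes :
  @measurable _ (n.-tuple T) = <<s measurable_boxes >>.
Proof.
apply/seteqP; split; last first.
  apply: smallest_sub; first exact: sigma_algebra_measurable.
  by move=> _ [B mB ->]; exact: measurable_box.
apply: smallest_sub; first exact: smallest_sigma_algebra.
move=> A; rewrite -bigcup_seq => -[i _ [B mB <-]].
apply: sub_sigma_algebra; exists (fun j => if j == i then B else setT).
  by move=> j; case: ifP.
apply/seteqP; split => [x [_ Bx] j|x Bx]; first by case: eqP => // ->.
by split => //; have := Bx i; rewrite eqxx.
Qed.

Lemma measurable_boxesI : setI_closed measurable_boxes.
Proof.
move=> _ _ [B mB ->] [C mC ->]; exists (fun i => B i `&` C i).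
  by move=> i; exact: measurableI.
by apply/seteqP; split => [x [Bx Cx] i|x BCx]; [split|split=> i; case: (BCx i)].
Qed.

End Boxes.
Arguments box {d T n} B.

Section Coordinates.
Context {R : realType} {n : nat}.
Implicit Types (x : n.-tuple R) (i j : 'I_n) (v : R).

Definition set_coord i v x : n.-tuple R :=
  [tuple if j == i then v else tnth x j | j < n].

Lemma tnth_set_coord i v x j :
  tnth (set_coord i v x) j = if j == i then v else tnth x j.
Proof. by rewrite tnth_mktuple. Qed.

Lemma set_coordK i u v x : set_coord i u (set_coord i v x) = set_coord i u x.
Proof. by apply: eq_from_tnth => j; rewrite !tnth_set_coord; case: eqP. Qed.

Lemma measurable_set_coord d (S : measurableType d) i (f : S -> R) (g : S -> n.-tuple R) :
  measurable_fun setT f -> measurable_fun setT g ->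
  measurable_fun setT (fun s => set_coord i (f s) (g s)).
Proof.
move=> mf mg; apply/measurable_fun_tnthP => j.
rewrite (_ : _ \o _ = fun s => if j == i then f s else tnth (g s) j).
  by case: eqP => // _; apply: (measurableT_comp (measurable_tnth j)).
by apply/funext => s /=; rewrite tnth_set_coord.
Qed.

End Coordinates.

Section Shear.
Context {R : realType} {d : measure_display} {T : measurableType d}.
Context {P : probability T R} {n : nat}.
Variables (Z : 'I_n -> {RV P >-> R}) (b : 'I_n -> R).
Hypothesis b_gt0 : forall i, 0 < b i.
Hypothesis Z_laplace : forall i, laplace_distributed (b i) (Z i).
Hypothesis Z_indep : forall B : 'I_n -> set R, (forall i, measurable (B i)) ->
  P (\bigcap_i (Z i @^-1` B i)) = (\prod_i P (Z i @^-1` B i))%E.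

Definition noise_tuple (w : T) : n.-tuple R := [tuple Z i w | i < n].

Lemma measurable_noise_tuple : measurable_fun setT noise_tuple.
Proof.
apply/measurable_fun_tnthP => i; rewrite (_ : _ \o _ = Z i)//.
by apply/funext => w /=; rewrite tnth_mktuple.
Qed.

(** The noise with coordinate [i] erased: keeping the type of full tuples avoids a
separate type of tuples indexed by the remaining coordinates. *)
Definition others i (w : T) : n.-tuple R := set_coord i 0 (noise_tuple w).

Lemma measurable_others i : measurable_fun setT (others i).
Proof. by apply: measurable_set_coord => //; exact: measurable_noise_tuple. Qed.

HB.instance Definition _ i := isMeasurableFun.Build _ _ _ _ _ (measurable_others i).

(** Both sides are finite measures in [A] that agree on boxes by mutual
independence.  The value 0 stored at the erased coordinate decides whether the
condition of the box on that coordinate holds always or never. *)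
Lemma others_indep i A B : measurable A -> measurable B ->
  P (others i @^-1` A `&` Z i @^-1` B) = (P (others i @^-1` A) * P (Z i @^-1` B))%E.
Proof.
move=> mA mB.
have mZB : measurable (Z i @^-1` B).
  by rewrite -[X in measurable X]setTI; exact: (measurable_funP (Z i)).
have pB : P (Z i @^-1` B) \is a fin_num by exact: fin_num_measure.
pose m1 := pushforward (mrestr P mZB) (others i).
have c0 : 0 <= fine (P (Z i @^-1` B)) by exact: fine_ge0.
pose m2 := mscale (NngNum c0) (distribution P (others i)).
suff : m1 A = m2 A.
  rewrite /m1 /m2 /pushforward /mscale /mrestr/= => ->.
  by rewrite fineK// muleC.
have mo : measurable_fun setT (others i) by exact: measurable_others.
apply: (measure_unique (@measurable_boxes _ R n) (fun=> setT)) => //.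
- exact: measurable_tuple_boxes.
- exact: measurable_boxesI.
- move=> _; exists (fun=> setT) => //.
  by apply/seteqP; split.
- by rewrite bigcup_const//.
- move=> _ [C mC ->]; change (P (others i @^-1` box C `&` Z i @^-1` B) =
    (fine (P (Z i @^-1` B)))%:E * P (others i @^-1` box C))%E.
  rewrite fineK//.
  have [C0|C0] := pselect (C i 0); last first.
    rewrite (_ : others i @^-1` _ = set0) ?set0I ?measure0 ?mule0//.
    rewrite -subset0 => w /(_ i); rewrite tnth_set_coord eqxx.
    exact: C0.
  pose C' B' j := if j == i then B' else C j.
  have mC' B' : measurable B' -> forall j, measurable (C' B' j).
    by move=> mB' j; rewrite /C'; case: ifP.
  have oE B' : others i @^-1` box C `&` Z i @^-1` B' = \bigcap_j (Z j @^-1` C' B' j).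
    apply/seteqP; split => [w [/= wC wB] j _|w wC].
      rewrite /C'; case: eqP => [->//|/eqP ji].
      by have := wC j; rewrite /= tnth_set_coord (negbTE ji) tnth_mktuple.
    split; last by have := wC i I; rewrite /C' eqxx.
    move=> j; rewrite tnth_set_coord; case: eqP => [->//|/eqP ji].
    by have := wC j I; rewrite /C' (negbTE ji) tnth_mktuple.
  have oPE B' : measurable B' -> P (others i @^-1` box C `&` Z i @^-1` B') =
      (P (Z i @^-1` B') * \prod_(j | j != i) P (Z j @^-1` C j))%E.
    move=> mB'; rewrite oE Z_indep; last exact: mC'.
    rewrite (bigD1 i)//= /C' eqxx; congr (_ * _)%E.
    by apply: eq_bigr => j /negbTE ->.
  rewrite oPE// ; congr (_ * _)%E.
  have := oPE setT measurableT; rewrite preimage_setT setIT probability_setT mul1e.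
  by move=> <-.
- move=> _; change (P (others i @^-1` setT `&` Z i @^-1` B) < +oo)%E.
  rewrite preimage_setT setTI.
  by rewrite ltey_eq fin_num_measure.
Qed.

Definition shift_coord i (h : n.-tuple R -> R) (x : n.-tuple R) : n.-tuple R :=
  set_coord i (tnth x i + h x) x.

(** The joint law of an independent pair is the product of the laws, and Tonelli
separates the two integrations. *)
Lemma integral_others i (F : n.-tuple R * R -> \bar R) :
  measurable_fun setT F -> (forall z, 0 <= F z)%E ->
  (\int[P]_w F (others i w, Z i w) =
   \int[distribution P (others i)]_u \int[distribution P (Z i)]_v F (u, v))%E.
Proof.
move=> mF F0.
have mp : measurable_fun setT (fun w => (others i w, Z i w)).
  by apply/measurable_fun_pairP; split;
    [exact: measurable_others|exact: measurable_funP (Z i)].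
have := ge0_integral_pushforward mp P measurableT mF (fun x _ => F0 x).
rewrite preimage_setT => <-.
rewrite -(fubini_tonelli1 F)//.
apply: eq_measure_integral => A mA _.
apply/esym/product_measure_unique => // B C mB mC.
by rewrite /distribution /pushforward -others_indep.
Qed.

Lemma noise_tuple_others i w : noise_tuple w = set_coord i (Z i w) (others i w).
Proof.
apply: eq_from_tnth => j; rewrite !tnth_set_coord tnth_mktuple.
by case: eqP => [->|].
Qed.

(** Given the other coordinates the shift is a constant, so this is the translation
bound of the Laplace law under the outer integral. *)
Lemma integral_shift_coord i h (F : n.-tuple R -> \bar R) :
  measurable_fun setT h -> (forall v x, h (set_coord i v x) = h x) ->
  measurable_fun setT F -> (forall x, 0 <= F x)%E ->
  (\int[P]_w (F (shift_coord i h (noise_tuple w)) *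
     (expR (- (`|h (noise_tuple w)| / b i)))%:E) <= \int[P]_w F (noise_tuple w))%E.
Proof.
move=> mh hi mF F0.
pose F1 (z : n.-tuple R * R) := (F (set_coord i (z.2 + h z.1) z.1) *
  (expR (- (`|h z.1| / b i)))%:E)%E.
pose F2 (z : n.-tuple R * R) := F (set_coord i z.2 z.1).
have mF1 : measurable_fun setT F1.
  have mh1 : measurable_fun setT (fun z : n.-tuple R * R => h z.1).
    exact: measurableT_comp.
  apply: emeasurable_funM.
    apply: measurableT_comp => //; apply: measurable_set_coord => //.
    by apply: measurable_funD.
  apply/measurable_EFinP; apply: measurableT_comp => //.
  apply: measurableT_comp => //; apply: measurable_funM => //.
  exact: measurableT_comp.
have mF2 : measurable_fun setT F2.
  by apply: measurableT_comp => //; exact: measurable_set_coord.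
have -> : (\int[P]_w F (noise_tuple w) = \int[P]_w F2 (others i w, Z i w))%E.
  by apply: eq_integral => w _; rewrite /F2/= -noise_tuple_others.
have -> : (\int[P]_w (F (shift_coord i h (noise_tuple w)) *
     (expR (- (`|h (noise_tuple w)| / b i)))%:E) =
     \int[P]_w F1 (others i w, Z i w))%E.
  apply: eq_integral => w _; rewrite /F1 /shift_coord /= (noise_tuple_others i).
  by rewrite set_coordK tnth_set_coord eqxx hi.
have F10 z : (0 <= F1 z)%E by rewrite /F1 mule_ge0// lee_fin expR_ge0.
have F20 z : (0 <= F2 z)%E by exact: F0.
rewrite !integral_others//.
apply: ge0_le_integral => //.
- by move=> u _; exact: integral_ge0.
- exact: measurable_fun_fubini_tonelli_F.
- exact: measurable_fun_fubini_tonelli_F.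
move=> u _; rewrite /F1 /F2/=.
have mFu : measurable_fun setT (fun v : R => F (set_coord i v u)).
  by apply: measurableT_comp => //; exact: measurable_set_coord.
have mFs : measurable_fun setT (fun v : R => F (set_coord i (v + h u)%R u)).
  by apply: measurableT_comp => //; apply: measurable_set_coord => //;
    exact: measurable_funD.
rewrite ge0_integralZr//.
have := @laplace_integral_shift R _ (b i) (b_gt0 i)
  (Z_laplace i) (h u) _ mFu (fun=> F0 _).
move=> /(lee_wpmul2r _) => /(_ (expR (- (`|h u| / b i)))%:E).
rewrite lee_fin expR_ge0 => /(_ isT) /le_trans; apply.
by rewrite muleAC -EFinM -expRD subrr expR0 mul1e.
Qed.

Variable rank : 'I_n -> nat.
Variable h : 'I_n -> n.-tuple R -> R.
Hypothesis measurable_h : forall i, measurable_fun setT (h i).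
Hypothesis h_causal : forall i x y,
  (forall j, (rank j < rank i)%N -> tnth x j = tnth y j) -> h i x = h i y.

(** The coordinates late in [s] are moved first: when the turn of [i] comes, the
earlier coordinates that [h i] reads are still the original ones. *)
Definition shear (s : seq 'I_n) (x : n.-tuple R) : n.-tuple R :=
  foldr (fun i => shift_coord i (h i)) x s.

Let path_rank_le i s k : path (relpre rank leq) i s -> k \in s ->
  (rank i <= rank k)%N.
Proof.
have tr : transitive (relpre rank leq) by move=> ? ? ?; exact: leq_trans.
by rewrite path_sortedE// => /andP[/allP le_is _] /le_is.
Qed.

(** Since [s] is sorted by rank, no coordinate read by [h i] has been moved before
[i] itself, so all shifts are evaluated at the original tuple. *)
Lemma tnth_shear s x j : uniq s -> sorted (relpre rank leq) s ->
  tnth (shear s x) j = tnth x j + (if j \in s then h j x else 0).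
Proof.
elim: s j => [|i s IHs] j /=; first by rewrite addr0.
move=> /andP[iNs us] pis.
have le_is k : k \in s -> (rank i <= rank k)%N := path_rank_le _ _ k pis.
rewrite tnth_set_coord inE; case: eqVneq => [->|ji] /=; last first.
  by apply: IHs => //; exact: path_sorted pis.
rewrite IHs ?(path_sorted pis)// (negbTE iNs) addr0; congr (_ + _).
apply: h_causal => k ki; rewrite IHs ?(path_sorted pis)//.
case: ifP => [ks|_]; last by rewrite addr0.
by have := le_is _ ks; rewrite leqNgt ki.
Qed.

(** Induction on [s]: the integrand for [i :: s] is the discounted one-coordinate
shift of [F], evaluated at the tuple sheared along [s]; the latter agrees with
the original tuple on everything that [h i] reads. *)
Lemma integral_shear s (F : n.-tuple R -> \bar R) :
  uniq s -> sorted (relpre rank leq) s ->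
  measurable_fun setT F -> (forall x, 0 <= F x)%E ->
  (\int[P]_w (F (shear s (noise_tuple w)) *
     (expR (- (\sum_(i <- s) `|h i (noise_tuple w)| / b i)))%:E)
   <= \int[P]_w F (noise_tuple w))%E.
Proof.
elim: s F => [|i s IHs] F /= us ps mF F0.
  by under eq_integral => w _ do rewrite big_nil oppr0 expR0 mule1.
case/andP: us => iNs us.
have le_is k : k \in s -> (rank i <= rank k)%N := path_rank_le _ _ k ps.
pose G x := (F (shift_coord i (h i) x) * (expR (- (`|h i x| / b i)))%:E)%E.
have mG : measurable_fun setT G.
  apply: emeasurable_funM.
    apply: measurableT_comp => //; apply: measurable_set_coord => //.
    by apply: measurable_funD => //; exact: measurable_tnth.
  apply/measurable_EFinP; apply: measurableT_comp => //.
  apply: measurableT_comp => //; apply: measurable_funM => //.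
  exact: measurableT_comp.
have G0 x : (0 <= G x)%E by rewrite /G mule_ge0// lee_fin expR_ge0.
have h_coord v x : h i (set_coord i v x) = h i x.
  apply: h_causal => j; rewrite tnth_set_coord; case: eqP => [->|//].
  by rewrite ltnn.
apply: le_trans (integral_shift_coord i _ F (measurable_h i) h_coord mF F0).
have := IHs G us (path_sorted ps) mG G0; congr (_ <= _)%O.
apply: eq_integral => w _; rewrite /G big_cons opprD expRD EFinM muleA.
rewrite (_ : h i (shear s (noise_tuple w)) = h i (noise_tuple w))//.
apply: h_causal => k ki; rewrite tnth_shear ?(path_sorted ps)//.
case: ifP => [ks|_]; last by rewrite addr0.
by have := le_is _ ks; rewrite leqNgt ki.
Qed.

Lemma measurable_shear s : measurable_fun setT (shear s).
Proof.
elim: s => [|i s IHs] /=; first exact: measurable_id.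
apply: (measurableT_comp (f := shift_coord i (h i))) => //.
apply: measurable_set_coord => //.
by apply: measurable_funD => //; exact: measurable_tnth.
Qed.

Notation cost s w := (\sum_(i <- s) `|h i (noise_tuple w)| / b i).

Lemma measurable_shift_cost s : measurable_fun setT (fun w => cost s w).
Proof.
apply: measurable_sum => i; apply: measurable_funM => //.
apply: measurableT_comp => //; apply: measurableT_comp => //.
exact: measurable_noise_tuple.
Qed.

Section ShearedEvents.
Variable s : seq 'I_n.
Hypotheses (s_uniq : uniq s) (s_sorted : sorted (relpre rank leq) s).
Variable B : set (n.-tuple R).
Hypothesis measurable_B : measurable B.

Let sheared w := shear s (noise_tuple w).

Let measurable_sheared : measurable_fun setT sheared.
Proof.
by apply: measurableT_comp; [exact: measurable_shear|exact: measurable_noise_tuple].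
Qed.

Let measurable_indic_sheared : measurable_fun setT (fun w => \1_B (sheared w) : R).
Proof. by apply: measurableT_comp => //; exact: measurable_indic. Qed.

Let discounted w : \bar R := ((\1_B (sheared w))%:E * (expR (- cost s w))%:E)%E.

Let measurable_discounted : measurable_fun setT discounted.
Proof.
apply: emeasurable_funM; apply/measurable_EFinP; first exact: measurable_indic_sheared.
apply: measurableT_comp => //; apply: measurableT_comp => //.
exact: measurable_shift_cost.
Qed.

Let discounted_ge0 w : (0 <= discounted w)%E.
Proof. by rewrite mule_ge0 ?lee_fin ?expR_ge0. Qed.

Let measurable_preimage_noise : measurable (noise_tuple @^-1` B).
Proof. by rewrite -[X in measurable X]setTI; exact: measurable_noise_tuple. Qed.

Let measurable_preimage_sheared : measurable (sheared @^-1` B).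
Proof. by rewrite -[X in measurable X]setTI; exact: measurable_sheared. Qed.

Let integral_discounted : (\int[P]_w discounted w <= P (noise_tuple @^-1` B))%E.
Proof.
have mB1 : measurable_fun setT (fun x => (\1_B x)%:E : \bar R).
  by apply/measurable_EFinP; exact: measurable_indic.
have B10 x : (0 <= (\1_B x)%:E :> \bar R)%E by rewrite lee_fin.
apply: le_trans (integral_shear s _ s_uniq s_sorted mB1 B10) _.
have := integral_indic P measurableT measurable_preimage_noise.
by rewrite setIT => <-.
Qed.

(** The discount factor is positive, so a null discounted integral forces the
indicator to vanish almost everywhere. *)
Lemma shear_null : P (noise_tuple @^-1` B) = 0%E -> P (sheared @^-1` B) = 0%E.
Proof.
move=> PB0.
have : (\int[P]_w `|discounted w| = 0)%E.
  apply/eqP; rewrite eq_le integral_ge0// andbT.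
  under eq_integral do rewrite gee0_abs//.
  by rewrite (le_trans integral_discounted) ?PB0.
move=> /(ae_eq_integral_abs P measurableT measurable_discounted) D0.
apply: measure_negligible => //.
apply: negligibleS D0 => w Bw /(_ I) /eqP.
rewrite /discounted indicE mem_set//= mul1e eqe => /eqP e0.
by have := expR_gt0 (- cost s w); rewrite e0 ltxx.
Qed.

(** On the event [cost <= e] the discount is at least [expR (- e)]. *)
Lemma shear_privacy (e : R) : {ae P, forall w, cost s w <= e} ->
  (P (sheared @^-1` B) <= (expR e)%:E * P (noise_tuple @^-1` B))%E.
Proof.
move=> cost_le.
have <- : (\int[P]_w (\1_B (sheared w))%:E = P (sheared @^-1` B))%E.
  have := integral_indic P measurableT measurable_preimage_sheared.
  by rewrite setIT => <-.
apply: (@le_trans _ _ (\int[P]_w ((expR e)%:E * discounted w))%E); last first.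
  rewrite ge0_integralZl//.
  by rewrite lee_wpmul2l// lee_fin expR_ge0.
apply: ae_ge0_le_integral => //.
- exact/measurable_EFinP.
- by move=> w _; rewrite mule_ge0// lee_fin expR_ge0.
- exact: emeasurable_funM.
apply: filterS cost_le => w we _; rewrite /discounted.
rewrite muleCA -EFinM -expRD lee_fin ler_peMr// -expR0 ler_expR; lra.
Qed.

End ShearedEvents.

End Shear.

(** * Measurability of gradients along measurable vectors *)

Section MeasurableVectors.
Context {R : realType} {d : measure_display} {E : measurableType d} {r : nat}.
Implicit Types (u v : E -> 'rV[R]_r) (f : 'rV[R]_r -> R).

Definition measurable_vec u : Prop :=
  forall j, measurable_fun setT (fun x => u x 0 j).

Lemma measurable_vecD u v : measurable_vec u -> measurable_vec v ->
  measurable_vec (fun x => u x + v x).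
Proof.
move=> mu mv j; under eq_fun do rewrite mxE.
exact: measurable_funD.
Qed.

Lemma measurable_vecZ (a : R) u : measurable_vec u ->
  measurable_vec (fun x => a *: u x).
Proof.
move=> mu j; under eq_fun do rewrite mxE.
exact: measurable_funM.
Qed.

Lemma measurable_vecB u v : measurable_vec u -> measurable_vec v ->
  measurable_vec (fun x => u x - v x).
Proof.
move=> mu mv; under eq_fun do rewrite -scaleN1r.
by apply: measurable_vecD => //; exact: measurable_vecZ.
Qed.

Lemma measurable_vec_sum (I : finType) (Q : pred I) (F : I -> E -> 'rV[R]_r) :
  (forall i, measurable_vec (F i)) ->
  measurable_vec (fun x => \sum_(i | Q i) F i x).
Proof.
move=> mF j; under eq_fun do rewrite summxE big_mkcond.
by apply: measurable_sum => i; case: (Q i) => //; exact: mF.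
Qed.

(** The lower corner of the cell of side [m.+1%:R^-1] that contains [v]. *)
Definition grid (m : nat) (v : 'rV[R]_r) : 'rV[R]_r :=
  \row_j ((Num.floor (m.+1%:R * v 0 j))%:~R / m.+1%:R).

Lemma grid_cvg (v : 'rV[R]_r) : grid m v @[m --> \oo] --> v.
Proof.
move=> A [B vB sBA].
have gB i : \forall m \near \oo, B 0 i (grid m v 0 i).
  have : grid m v 0 i @[m --> \oo] --> v 0 i; last exact.
  apply: (@squeeze_cvgr _ _ _ _ (fun m => v 0 i - harmonic m) (fun=> v 0 i)).
  - near=> m; rewrite mxE /harmonic.
    have m0 : 0 < m.+1%:R :> R by rewrite ltr0n.
    rewrite ler_pdivlMr// ler_pdivrMr// mulrBl mulVf ?gt_eqF// mulrC.
    by rewrite floor_le andbT lerBlDr -intrD1 ltW// floorD1_gt.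
  - rewrite -[X in _ --> X]subr0; apply: cvgB; first exact: cvg_cst.
    exact: cvg_harmonic.
  - exact: cvg_cst.
have : \forall m \near \oo, forall i, B 0 i (grid m v 0 i) by exact: filter_forall.
by apply: filterS => m gm; apply: sBA => i j; rewrite (ord1 i).
Unshelve. all: by end_near. Qed.

(** A function of the cell takes countably many values, each on a measurable set,
so it is measurable whatever its values are. *)
Lemma measurable_grid_comp m f u : measurable_vec u ->
  measurable_fun setT (fun x => f (grid m (u x))).
Proof.
move=> mu _ B mB; rewrite setTI.
pose cell (z : 'rV[int]_r) : set E :=
  [set x | forall j, u x 0 j \in `[(z 0 j)%:~R / m.+1%:R, (z 0 j + 1)%:~R / m.+1%:R[].
have m0 : 0 < m.+1%:R :> R by rewrite ltr0n.
pose center (z : 'rV[int]_r) : 'rV[R]_r := \row_j ((z 0 j)%:~R / m.+1%:R).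
have cellP x z : cell z x -> grid m (u x) = center z.
  move=> xz; apply/rowP => j; rewrite !mxE; congr (_%:~R / _).
  have := xz j; rewrite in_itv/= ler_pdivrMr// ltr_pdivlMr// mulrC => h.
  exact: floor_def.
rewrite (_ : _ @^-1` _ = \bigcup_z (cell z `&` [set _ | B (f (center z))])).
  apply: countable_bigcupT_measurable => // z.
  apply: measurableI.
    rewrite (_ : cell z = \bigcap_(j in [set` 'I_r]) ((fun x => u x 0 j) @^-1`
       [set` `[(z 0 j)%:~R / m.+1%:R, (z 0 j + 1)%:~R / m.+1%:R[])).
      apply: fin_bigcap_measurable => // j _.
      by rewrite -[X in measurable X]setTI; apply: mu.
    by apply/seteqP; split=> [x xz j _|x xz j]; exact: xz.
  by have [fB|fB] := pselect (B (f (center z)));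
    [rewrite (_ : [set _ | _] = setT)|rewrite (_ : [set _ | _] = set0)] => //;
    apply/seteqP; split.
apply/seteqP; split=> [x /= Bx|x [z _ [/cellP xz /=]]]; last by rewrite xz.
pose z : 'rV[int]_r := \row_j Num.floor (m.+1%:R * u x 0 j).
have xz : cell z x.
  move=> j; rewrite in_itv/= !mxE ler_pdivrMr// ltr_pdivlMr// mulrC.
  by rewrite floor_le floorD1_gt.
by exists z => //; split => //=; rewrite -(cellP _ _ xz).
Qed.

(** Borel measurability in the product sense is coordinatewise, while continuity
is about the topology of the whole vector space; the grid approximation bridges
the two without comparing open sets with products. *)
Lemma measurable_continuous_comp f u : continuous f -> measurable_vec u ->
  measurable_fun setT (fun x => f (u x)).
Proof.
move=> cf mu.
apply: (@measurable_fun_cvg _ _ _ _ (fun m x => f (grid m (u x)))).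
  by move=> m; exact: measurable_grid_comp.
by move=> x _; apply: (cvg_comp _ f (grid_cvg (u x))); exact: cf.
Qed.

(** Partial derivatives are pointwise limits of difference quotients, which are
continuous in the point. *)
Lemma measurable_gradient_comp f u : (forall x, differentiable f x) ->
  measurable_vec u -> measurable_vec (fun x => gradient f (u x)).
Proof.
move=> df mu j.
pose e : 'rV[R]_r := delta_mx 0 j.
apply: (@measurable_fun_cvg _ _ _ _ (fun m x =>
  m.+1%:R * (f (harmonic m *: e + u x) - f (u x)))).
  move=> m; apply: measurable_funM => //; apply: measurable_funB.
    apply: measurable_continuous_comp.
      by move=> x; exact: differentiable_continuous.
    apply: measurable_vecD => //.
  by apply: measurable_continuous_comp => // x; exact: differentiable_continuous.
move=> x _; rewrite mxE.
have : derivable f (u x) e by exact: diff_derivable.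
move=> /cvgr_dnbhsP /(_ (@harmonic R)) dfh.
have /dfh : (forall k, @harmonic R k != 0) /\ @harmonic R k @[k --> \oo] --> 0.
  by split; [move=> k; rewrite gt_eqF ?harmonic_gt0|exact: cvg_harmonic].
by under eq_fun do rewrite /= invrK.
Qed.

End MeasurableVectors.

(** * Replaying observations and the sensitivity of the states *)

Section Norm1.
Context {R : realType} {r : nat}.
Implicit Types u v : 'rV[R]_r.

Definition norm1 v : R := \sum_j `|v 0 j|.

Lemma norm1_ge0 v : 0 <= norm1 v.
Proof. exact: sumr_ge0. Qed.

Lemma norm1D u v : norm1 (u + v) <= norm1 u + norm1 v.
Proof.
by rewrite /norm1 -big_split ler_sum// => j _; rewrite mxE ler_normD.
Qed.

Lemma norm1Z a v : norm1 (a *: v) = `|a| * norm1 v.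
Proof. by rewrite /norm1 mulr_sumr; apply: eq_bigr => j _; rewrite mxE normrM. Qed.

Lemma norm10 : norm1 0 = 0.
Proof. by rewrite /norm1 big1// => j _; rewrite mxE normr0. Qed.

Lemma norm1B u v : norm1 (u - v) <= norm1 u + norm1 v.
Proof.
by apply: (le_trans (norm1D _ _)); rewrite -scaleN1r norm1Z normrN1 mul1r.
Qed.

Lemma norm1_sum (I : Type) (s : seq I) (F : I -> 'rV[R]_r) :
  norm1 (\sum_(i <- s) F i) <= \sum_(i <- s) norm1 (F i).
Proof.
elim/big_ind2: _ => //; first by rewrite norm10.
by move=> u a v c ua vc; apply: (le_trans (norm1D _ _)); exact: lerD.
Qed.

(** Cauchy--Schwarz against the all-ones vector, from the sum over all pairs
[(i, j)] of the nonnegative numbers (|v_i| - |v_j|)^2. *)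
Lemma norm1_le_norm2 v : norm1 v <= Num.sqrt r%:R * norm2 v.
Proof.
rewrite /norm2 -sqrtrM ?ler0n//.
rewrite -[leLHS]ger0_norm ?norm1_ge0// -sqrtr_sqr ler_wsqrtr//.
rewrite expr2 /norm1 mulr_suml.
under eq_bigr do rewrite mulr_sumr.
have -> : r%:R * (\sum_j v 0 j ^+ 2) =
    \sum_(i < r) \sum_(j < r) (v 0 i ^+ 2 + v 0 j ^+ 2) / 2.
  under [RHS]eq_bigr => i _ do rewrite -mulr_suml big_split/= sumr_const card_ord.
  rewrite -mulr_suml big_split/= sumrMnl sumr_const card_ord mulr_natl.
  by field.
apply: ler_sum => i _; apply: ler_sum => j _.
rewrite -(real_normK (num_real (v 0 i))) -(real_normK (num_real (v 0 j))).
have := sqr_ge0 (`|v 0 i| - `|v 0 j|); nra.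
Qed.

End Norm1.

Section Replay.
Context {R : realType} {n r : nat}.
Variables (alpha : R) (gamma beta : nat -> R).
Implicit Types (q : problem R n r) (z : state R n r).

Definition broadcast : Type := ('I_n -> 'rV[R]_r) * ('I_n -> 'rV[R]_r).

(** The update of an agent as a function of its own state and of the messages
received; the noise enters through the messages only. *)
Definition step_tracker q k z (o : broadcast) i : 'rV[R]_r :=
  weights q i i *: tracker z i + \sum_(j | j != i) weights q i j *: o.1 j
  + gamma k *: gradient (local_obj q i) (decision z i).

Definition step_decision q k z (o : broadcast) i : 'rV[R]_r :=
  weights q i i *: decision z i + \sum_(j | j != i) weights q i j *: o.2 j
  - alpha *: (step_tracker q k z o i - tracker z i).

Definition step q k z o := State (step_tracker q k z o) (step_decision q k z o).

Fixpoint replay q z0 (o : nat -> broadcast) k : state R n r :=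
  if k is k'.+1 then step q k' (replay q z0 o k') (o k') else z0.

Definition perturb k z (e : broadcast) : broadcast :=
  (fun i => tracker z i + beta k *: e.1 i, fun i => decision z i + beta k *: e.2 i).

Fixpoint run q z0 (e : nat -> broadcast) k : state R n r :=
  if k is k'.+1 then
    let z := run q z0 e k' in step q k' z (perturb k' z (e k'))
  else z0.

Definition observed q z0 e k : broadcast := perturb k (run q z0 e k) (e k).

Lemma run_replay q z0 e k : run q z0 e k = replay q z0 (observed q z0 e) k.
Proof. by elim: k => [//|k IHk]; rewrite [RHS]/= -IHk. Qed.

Lemma eq_replay q z0 o o' k : (forall t, (t < k)%N -> o t = o' t) ->
  replay q z0 o k = replay q z0 o' k.
Proof.
elim: k => [//|k IHk] oo'; rewrite [LHS]/= [RHS]/= IHk; first by rewrite oo'.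
by move=> t tk; apply: oo'; exact: ltnW.
Qed.

Lemma eq_run q z0 e e' k : (forall t, (t < k)%N -> e t = e' t) ->
  run q z0 e k = run q z0 e' k.
Proof.
elim: k => [//|k IHk] ee'; rewrite [LHS]/= [RHS]/= IHk; first by rewrite ee'.
by move=> t tk; apply: ee'; exact: ltnW.
Qed.

(** A noise that accounts for the messages [o] when added to the states replayed
from [o] makes the run go through exactly these states. *)
Lemma run_explaining q z0 o e K :
  (forall k, (k <= K)%N -> perturb k (replay q z0 o k) (e k) = o k) ->
  forall k, (k <= K)%N -> run q z0 e k = replay q z0 o k.
Proof.
move=> eo; elim=> [_|k IHk kK]; first by [].
have kK' := ltnW kK.
by rewrite [LHS]/= [RHS]/= (IHk kK') (eo k kK').
Qed.

End Replay.

Lemma sens_coef_last {R : realType} (w : R) k : w != 0 -> sens_coef w k.+1 k = -1.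
Proof.
move=> w0; rewrite /sens_coef (_ : _ - _ - _ = -1) ?exprN1; last by lia.
by rewrite -natr1; field.
Qed.

(** The inhomogeneous term comes from the tracker increment in the decision update. *)
Lemma sens_coefS {R : realType} (w : R) k t : w != 0 -> (t < k)%N ->
  sens_coef w k.+1 t = w * sens_coef w k t - (w - 1) * w ^+ (k - 1 - t).
Proof.
move=> w0 tk; rewrite /sens_coef.
rewrite (_ : k.+1%:Z - 2 - t%:Z = (k - 1 - t)%N%:Z); last by lia.
rewrite mulrA (_ : w * w ^ _ = w ^+ (k - 1 - t)).
  by rewrite -natr1 -exprnP; ring.
by rewrite -{1}(expr1z w) -expfzDr// exprnP; congr (_ ^ _); lia.
Qed.

Section Sensitivity.
Context {R : realType} {n r : nat}.
Variables (alpha : R) (gamma beta : nat -> R).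
Variables (p p' : problem R n r) (i0 : 'I_n).
Hypothesis eqW : weights p = weights p'.
Hypothesis eqf : forall j, j != i0 -> local_obj p j = local_obj p' j.
Variables (z0 : state R n r) (o : nat -> broadcast (R:=R) (n:=n) (r:=r)).

Notation z := (replay alpha gamma p z0 o).
Notation z' := (replay alpha gamma p' z0 o).
Notation w := (weights p i0 i0).

(** With the messages fixed, the agents no longer interact. *)
Lemma replay_unaffected j k : j != i0 ->
  tracker (z k) j = tracker (z' k) j /\ decision (z k) j = decision (z' k) j.
Proof.
move=> ji0; elim: k => [//|k [eqs eqx]].
have eqt : step_tracker gamma p k (z k) (o k) j = step_tracker gamma p' k (z' k) (o k) j.
  by rewrite /step_tracker eqW eqs eqx eqf.
by split; [exact: eqt|rewrite /= /step_decision eqt eqW eqs eqx].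
Qed.

Definition gradient_gap t : 'rV[R]_r :=
  gradient (local_obj p i0) (decision (z t) i0)
  - gradient (local_obj p' i0) (decision (z' t) i0).

Definition tracker_gap k := tracker (z k) i0 - tracker (z' k) i0.
Definition decision_gap k := decision (z k) i0 - decision (z' k) i0.

Lemma tracker_gapS k :
  tracker_gap k.+1 = w *: tracker_gap k + gamma k *: gradient_gap k.
Proof.
rewrite /tracker_gap/= /step_tracker -eqW !scalerBr.
by apply/rowP => j; rewrite !mxE; ring.
Qed.

Lemma decision_gapS k : decision_gap k.+1 =
  w *: decision_gap k - alpha *: (tracker_gap k.+1 - tracker_gap k).
Proof.
rewrite /decision_gap/= /step_decision /tracker_gap/= -eqW.
by apply/rowP => j; rewrite !mxE; ring.
Qed.

Lemma tracker_gapE k : tracker_gap k =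
  \sum_(0 <= t < k) (w ^+ (k - 1 - t) * gamma t) *: gradient_gap t.
Proof.
elim: k => [|k IHk]; first by rewrite big_nil /tracker_gap subrr.
rewrite tracker_gapS IHk big_nat_recr//= subSS subn0 subnn mul1r.
congr (_ + _); rewrite scaler_sumr; apply: eq_big_nat => t /andP[_ tk].
rewrite scalerA mulrA -exprS; congr ((_ ^+ _ * _) *: _); lia.
Qed.

(** The weight must be nonzero because the last coefficient, at [t = k - 1],
involves [w ^ -1]. *)
Lemma decision_gapE k : w != 0 -> decision_gap k =
  \sum_(0 <= t < k) (alpha * sens_coef w k t * gamma t) *: gradient_gap t.
Proof.
move=> w0; elim: k => [|k IHk]; first by rewrite big_nil /decision_gap subrr.
rewrite decision_gapS tracker_gapS IHk big_nat_recr//= sens_coef_last//.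
rewrite [\sum_(0 <= t < k) (alpha * sens_coef w k.+1 t * gamma t) *: _](_ : _ =
  w *: (\sum_(0 <= t < k) (alpha * sens_coef w k t * gamma t) *: gradient_gap t)
  - (alpha * (w - 1)) *: tracker_gap k).
  by apply/rowP => j; rewrite !mxE; ring.
rewrite tracker_gapE !scaler_sumr -sumrB; apply: eq_big_nat => t /andP[_ tk].
rewrite sens_coefS// !scalerA -scalerBl; congr (_ *: _); ring.
Qed.

Variables (C : R) (K : nat).
Hypothesis gradC : forall t, (t < K)%N ->
  norm2 (gradient (local_obj p i0) (decision (z t) i0)) <= C.
Hypothesis gradC' : forall t, (t < K)%N ->
  norm2 (gradient (local_obj p' i0) (decision (z' t) i0)) <= C.

(** The triangle inequality is applied to the 1-norm, each of the two gradients being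
then compared with its 2-norm. *)
Lemma norm1_gradient_gap t : (t < K)%N ->
  norm1 (gradient_gap t) <= 2 * Num.sqrt r%:R * C.
Proof.
move=> tK; apply: (le_trans (norm1B _ _)).
have s0 : 0 <= Num.sqrt r%:R :> R by exact: sqrtr_ge0.
have := ler_wpM2l s0 (gradC t tK); have := ler_wpM2l s0 (gradC' t tK).
have := norm1_le_norm2 (gradient (local_obj p i0) (decision (z t) i0)).
have := norm1_le_norm2 (gradient (local_obj p' i0) (decision (z' t) i0)).
lra.
Qed.

Variables (b_eta b_xi : R).
Hypotheses (alpha0 : 0 < alpha) (gamma0 : forall k, 0 < gamma k).
Hypotheses (beta0 : forall k, 0 < beta k) (w0 : 0 < w).
Hypotheses (b_eta0 : 0 < b_eta) (b_xi0 : 0 < b_xi).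

Lemma norm1_gaps_le k : (k <= K)%N ->
  norm1 (tracker_gap k) / (beta k * b_eta) + norm1 (decision_gap k) / (beta k * b_xi)
  <= 2 * Num.sqrt r%:R * C * (\sum_(0 <= t < k)
       (w ^+ (k - 1 - t) / (beta k * b_eta)
        + alpha * `|sens_coef w k t| / (beta k * b_xi)) * gamma t).
Proof.
move=> kK; rewrite tracker_gapE decision_gapE ?gt_eqF//.
have e0 : 0 < (beta k * b_eta)^-1 by rewrite invr_gt0 mulr_gt0.
have x0 : 0 < (beta k * b_xi)^-1 by rewrite invr_gt0 mulr_gt0.
apply: (@le_trans _ _ (\sum_(0 <= t < k)
    (norm1 ((w ^+ (k - 1 - t) * gamma t) *: gradient_gap t) / (beta k * b_eta) +
     norm1 ((alpha * sens_coef w k t * gamma t) *: gradient_gap t) / (beta k * b_xi)))).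
  rewrite big_split/= -!mulr_suml.
  by apply: lerD; rewrite ler_pM2r//; exact: norm1_sum.
rewrite mulr_sumr !big_nat; apply: ler_sum => t /andP[_ tk].
have tK : (t < K)%N by exact: leq_trans tk kK.
move: (sens_coef w k t) => c; rewrite !norm1Z !normrM (gtr0_norm alpha0)
  (gtr0_norm (gamma0 t)) normrX (gtr0_norm w0).
have A0 : 0 <= w ^+ (k - 1 - t) / (beta k * b_eta) * gamma t.
  by rewrite !mulr_ge0 ?exprn_ge0// ltW.
have B0 : 0 <= alpha * `|c| / (beta k * b_xi) * gamma t.
  by rewrite !mulr_ge0// ltW.
have g_le := norm1_gradient_gap t tK.
have := lerD (ler_wpM2l A0 g_le) (ler_wpM2l B0 g_le); by congr (_ <= _); ring.
Qed.

(** The gaps vanish at time 0, which is why the sum of the budget starts at 1. *)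
Lemma sum_norm1_gaps_le :
  \sum_(k < K.+1) (norm1 (tracker_gap k) / (beta k * b_eta)
                   + norm1 (decision_gap k) / (beta k * b_xi))
  <= 2 * Num.sqrt r%:R * C *
        (\sum_(1 <= k < K.+1) \sum_(0 <= t < k)
           (w ^+ (k - 1 - t) / (beta k * b_eta)
            + alpha * `|sens_coef w k t| / (beta k * b_xi)) * gamma t).
Proof.
pose F k := norm1 (tracker_gap k) / (beta k * b_eta)
   + norm1 (decision_gap k) / (beta k * b_xi).
rewrite -(big_mkord xpredT F) big_ltn// {1}/F.
rewrite {1}/tracker_gap {1}/decision_gap/= !subrr norm10 !mul0r !add0r.
rewrite mulr_sumr !big_nat; apply: ler_sum => k /andP[_ kK].
exact: norm1_gaps_le.
Qed.

End Sensitivity.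

(** * Measurable runs and the finite family of noise coordinates *)

Section MeasurableRuns.
Context {R : realType} {d : measure_display} {E : measurableType d} {n r : nat}.
Variables (alpha : R) (gamma beta : nat -> R) (q : problem R n r).
Hypothesis q_diff : forall i x, differentiable (local_obj q i) x.

Definition measurable_vecs (F : E -> 'I_n -> 'rV[R]_r) : Prop :=
  forall i, measurable_vec (fun x => F x i).

Definition measurable_state (z : E -> state R n r) : Prop :=
  measurable_vecs (fun x => tracker (z x)) /\ measurable_vecs (fun x => decision (z x)).

Definition measurable_broadcast (o : E -> broadcast (R:=R) (n:=n) (r:=r)) : Prop :=
  measurable_vecs (fun x => (o x).1) /\ measurable_vecs (fun x => (o x).2).

Lemma measurable_step k z o : measurable_state z -> measurable_broadcast o ->
  measurable_state (fun x => step alpha gamma q k (z x) (o x)).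
Proof.
move=> [ms mx] [mo1 mo2].
have mt i : measurable_vec (fun x => step_tracker gamma q k (z x) (o x) i).
  apply: measurable_vecD.
    apply: measurable_vecD; first exact: measurable_vecZ (ms i).
    by apply: measurable_vec_sum => j; exact: measurable_vecZ (mo1 j).
  exact: measurable_vecZ (measurable_gradient_comp _ _ (q_diff i) (mx i)).
split=> i; first exact: mt i.
apply: measurable_vecB.
  apply: measurable_vecD; first exact: measurable_vecZ (mx i).
  by apply: measurable_vec_sum => j; exact: measurable_vecZ (mo2 j).
exact: measurable_vecZ (measurable_vecB _ _ (mt i) (ms i)).
Qed.

Lemma measurable_perturb k z e : measurable_state z -> measurable_broadcast e ->
  measurable_broadcast (fun x => perturb beta k (z x) (e x)).
Proof.
move=> [ms mx] [me1 me2]; split=> i.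
  exact: measurable_vecD (ms i) (measurable_vecZ _ _ (me1 i)).
exact: measurable_vecD (mx i) (measurable_vecZ _ _ (me2 i)).
Qed.

Lemma measurable_replay z0 (o : E -> nat -> broadcast) k :
  (forall t, measurable_broadcast (fun x => o x t)) ->
  measurable_state (fun x => replay alpha gamma q z0 (o x) k).
Proof.
move=> mo; elim: k => [|k IHk] /=; last exact: measurable_step.
by split=> i j; exact: measurable_cst.
Qed.

Lemma measurable_run z0 (e : E -> nat -> broadcast) k :
  (forall t, measurable_broadcast (fun x => e x t)) ->
  measurable_state (fun x => run alpha gamma beta q z0 (e x) k).
Proof.
move=> me; elim: k => [|k IHk] /=.
  by split=> i j; exact: measurable_cst.
by apply: measurable_step => //; exact: measurable_perturb.
Qed.

Lemma measurable_observed z0 (e : E -> nat -> broadcast) k :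
  (forall t, measurable_broadcast (fun x => e x t)) ->
  measurable_broadcast (fun x => observed alpha gamma beta q z0 (e x) k).
Proof. by move=> me; apply: measurable_perturb => //; exact: measurable_run. Qed.

End MeasurableRuns.

Section ObservationTuples.
Context {R : realType} {n r K : nat}.

Definition observation_tuple (o : nat -> broadcast (R:=R) (n:=n) (r:=r)) :
    observations R n r K :=
  [tuple ([tuple [tuple (o k).1 i 0 j | j < r] | i < n],
          [tuple [tuple (o k).2 i 0 j | j < r] | i < n]) | k < K.+1].

Lemma eq_observation_tuple o o' : (forall k, (k <= K)%N -> o k = o' k) ->
  observation_tuple o = observation_tuple o'.
Proof.
move=> oo'; apply: eq_from_tnth => k; rewrite !tnth_mktuple oo'//.
by rewrite -ltnS.
Qed.

Lemma measurable_observation_tuple d (E : measurableType d)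
    (o : E -> nat -> broadcast (R:=R) (n:=n) (r:=r)) :
  (forall k, measurable_broadcast (fun x => o x k)) ->
  measurable_fun setT (fun x => observation_tuple (o x)).
Proof.
have mtup (F : E -> 'I_n -> 'rV[R]_r) : measurable_vecs F ->
    measurable_fun setT (fun x => [tuple [tuple F x i 0 j | j < r] | i < n]).
  move=> mF; apply/measurable_fun_tnthP => i; apply/measurable_fun_tnthP => j.
  rewrite (_ : _ \o _ = fun x => F x i 0 j); first exact: mF.
  by apply/funext => x /=; rewrite !tnth_mktuple.
move=> mo; apply/measurable_fun_tnthP => k.
rewrite (_ : _ \o _ = fun x =>
   ([tuple [tuple (o x k).1 i 0 j | j < r] | i < n],
    [tuple [tuple (o x k).2 i 0 j | j < r] | i < n])); last first.
  by apply/funext => x /=; rewrite tnth_mktuple.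
by have [m1 m2] := mo k; apply: measurable_fun_pair; exact: mtup.
Qed.

End ObservationTuples.

Section NoiseCoordinates.
Context {R : realType} {d : measure_display} {T : measurableType d}.
Context {P : probability T R} {n r K : nat}.
Variables eta xi : 'I_n -> nat -> 'I_r -> {RV P >-> R}.

Definition noise_index : finType :=
  (('I_n * 'I_K.+1 * 'I_r) + ('I_n * 'I_K.+1 * 'I_r))%type.

Definition to_joint (c : noise_index) : ('I_n * nat * 'I_r) + ('I_n * nat * 'I_r) :=
  match c with
  | inl (i, k, j) => inl (i, nat_of_ord k, j)
  | inr (i, k, j) => inr (i, nat_of_ord k, j)
  end.

(** A left inverse of [to_joint]: with it, events given on the finite family extend
to the whole family. *)
Definition of_joint (c : ('I_n * nat * 'I_r) + ('I_n * nat * 'I_r)) : noise_index :=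
  match c with
  | inl (i, k, j) => inl (i, inord k, j)
  | inr (i, k, j) => inr (i, inord k, j)
  end.

Lemma to_jointK : cancel to_joint of_joint.
Proof. by move=> [[[i k] j]|[[i k] j]] /=; rewrite inord_val. Qed.

Notation dim := #|noise_index|.

Definition noise_coord (c : 'I_dim) : {RV P >-> R} :=
  joint_noise eta xi (to_joint (enum_val c)).

(** Mutual independence of the whole family is used for the subfamily of all noises
up to time [K]. *)
Lemma noise_coord_indep : mutually_independent (joint_noise eta xi) ->
  forall B : 'I_dim -> set R, (forall c, measurable (B c)) ->
  P (\bigcap_c (noise_coord c @^-1` B c)) =
  (\prod_c P (noise_coord c @^-1` B c))%E.
Proof.
move=> indep B mB.
pose f (c : 'I_dim) := to_joint (enum_val c).
pose g q : 'I_dim := enum_rank (of_joint q).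
have fK : cancel f g by move=> c; rewrite /g /f to_jointK enum_valK.
have uJ : uniq [seq f c | c <- index_enum 'I_dim].
  by rewrite map_inj_uniq ?index_enum_uniq//; exact: can_inj fK.
have := indep _ (fun q => B (g q)) uJ (fun q => mB (g q)).
rewrite big_map; under [X in _ = X -> _]eq_bigr => c _ do rewrite fK.
move=> <-; congr (P _); apply/seteqP; split=> [w Bw q /= /mapP[c _ ->]|w Bw c _].
  by rewrite fK; exact: Bw.
have := Bw (f c); rewrite fK; apply => /=.
by rewrite map_f// mem_index_enum.
Qed.

Definition noise_time (c : 'I_dim) : nat :=
  match enum_val c with inl (_, k, _) | inr (_, k, _) => k end.

(** Because of [inord] this is the noise of time [k] for [k <= K] only. *)
Definition noise_broadcast (x : dim.-tuple R) (k : nat) :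
    broadcast (R:=R) (n:=n) (r:=r) :=
  (fun i => \row_j tnth x (enum_rank (inl (i, inord k, j) : noise_index)),
   fun i => \row_j tnth x (enum_rank (inr (i, inord k, j) : noise_index))).

Lemma measurable_noise_broadcast k : measurable_broadcast (noise_broadcast ^~ k).
Proof.
by split=> i j; under eq_fun do rewrite mxE; exact: measurable_tnth.
Qed.

Lemma noise_broadcastE w k : (k <= K)%N ->
  noise_broadcast (noise_tuple noise_coord w) k =
  (fun i => noise_vector eta i k w, fun i => noise_vector xi i k w).
Proof.
move=> kK; congr pair; apply/funext => i; apply/rowP => j;
  by rewrite !mxE tnth_mktuple /noise_coord enum_rankK /= inordK.
Qed.

Lemma iterate_run alpha gamma beta q z0 w k : (k <= K.+1)%N ->
  iterate alpha gamma beta eta xi q z0 w k =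
  run alpha gamma beta q z0 (noise_broadcast (noise_tuple noise_coord w)) k.
Proof.
elim: k => [//|k IHk] kK.
by rewrite [RHS]/= -(IHk (ltnW kK)) noise_broadcastE.
Qed.

Lemma algE alpha gamma beta q z0 w :
  alg alpha gamma beta eta xi K q z0 w =
  observation_tuple (observed alpha gamma beta q z0
    (noise_broadcast (noise_tuple noise_coord w))).
Proof.
apply: eq_from_tnth => k; rewrite !tnth_mktuple /observed.
rewrite -iterate_run ?noise_broadcastE//; first by rewrite -ltnS.
exact: ltnW.
Qed.

End NoiseCoordinates.

(** * The noise shift matching the observations of two problems *)

Section Coupling.
Context {R : realType} {n r K : nat}.
Variables (alpha : R) (gamma beta : nat -> R) (p p' : problem R n r).
Variable z0 : state R n r.
Hypothesis beta0 : forall k, 0 < beta k.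
Notation dim := #|@noise_index n r K|.
Notation e := (@noise_broadcast R n r K).
Implicit Types (x y : dim.-tuple R) (c : 'I_dim).

Definition seen x := observed alpha gamma beta p z0 (e x).
(** The states that [p'] goes through if it listens to the messages of [p]. *)
Definition shadow x := replay alpha gamma p' z0 (seen x).

Definition noise_shift c x : R :=
  match enum_val c with
  | inl (i, k, j) => (tracker (replay alpha gamma p z0 (seen x) k) i
                      - tracker (shadow x k) i) 0 j / beta k
  | inr (i, k, j) => (decision (replay alpha gamma p z0 (seen x) k) i
                      - decision (shadow x k) i) 0 j / beta k
  end.

(** States replayed at time [k] depend on messages of times before [k]. *)
Lemma noise_shift_causal c x y :
  (forall c', (noise_time c' < noise_time c)%N -> tnth x c' = tnth y c') ->
  noise_shift c x = noise_shift c y.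
Proof.
move=> xy.
have e_eq t : (t < noise_time c)%N -> e x t = e y t.
  move=> tc; have tK : (t < K.+1)%N.
    apply: (ltn_trans tc); rewrite /noise_time.
    by case: (enum_val c) => -[[i k] j].
  congr pair; apply/funext => i; apply/rowP => j; rewrite !mxE; apply: xy;
    by rewrite {1}/noise_time enum_rankK inordK.
have seen_eq t : (t < noise_time c)%N -> seen x t = seen y t.
  move=> tc; rewrite /seen /observed e_eq//.
  by congr perturb; apply: eq_run => u ut; apply: e_eq; exact: ltn_trans ut tc.
have replay_eq q : replay alpha gamma q z0 (seen x) (noise_time c) =
                   replay alpha gamma q z0 (seen y) (noise_time c).
  exact: eq_replay.
move: (replay_eq p) (replay_eq p'); rewrite /noise_shift /shadow /noise_time.
by case: (enum_val c) => -[[i k] j] -> ->.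
Qed.

Definition noise_order : seq 'I_dim := sort (relpre noise_time leq) (enum 'I_dim).

Lemma noise_order_uniq : uniq noise_order.
Proof. by rewrite sort_uniq enum_uniq. Qed.

Lemma noise_order_sorted : sorted (relpre noise_time leq) noise_order.
Proof. by apply: sort_sorted => c c'; exact: leq_total. Qed.

Lemma mem_noise_order c : c \in noise_order.
Proof. by rewrite mem_sort mem_enum. Qed.

Notation sheared := (shear noise_shift noise_order).

Lemma tnth_sheared x c : tnth (sheared x) c = tnth x c + noise_shift c x.
Proof.
rewrite (tnth_shear noise_time) ?mem_noise_order//.
- exact: noise_shift_causal.
- exact: noise_order_uniq.
- exact: noise_order_sorted.
Qed.

(** The shift is chosen so that the state difference and the noise difference
cancel in every message. *)
Lemma perturb_sheared x k : (k <= K)%N ->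
  perturb beta k (shadow x k) (e (sheared x) k) = seen x k.
Proof.
move=> kK; rewrite /perturb [RHS]/seen /observed run_replay -/(seen x) /perturb.
have bk := lt0r_neq0 (beta0 k).
congr pair; apply/funext => i; apply/rowP => j; rewrite !mxE tnth_sheared
  /noise_shift enum_rankK inordK// !mxE; by field.
Qed.

Lemma run_sheared x k : (k <= K)%N ->
  run alpha gamma beta p' z0 (e (sheared x)) k = shadow x k.
Proof. by apply: run_explaining => t tK; exact: perturb_sheared. Qed.

(** The coupling: the run of [p'] on the sheared noise follows the shadow, whose
messages are those of [p]. *)
Lemma observed_sheared x k : (k <= K)%N ->
  observed alpha gamma beta p' z0 (e (sheared x)) k = seen x k.
Proof. by move=> kK; rewrite /observed run_sheared// perturb_sheared. Qed.

Section Measurability.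
Hypothesis p_diff : forall i v, differentiable (local_obj p i) v.
Hypothesis p'_diff : forall i v, differentiable (local_obj p' i) v.

Lemma measurable_noise_shift c : measurable_fun setT (noise_shift c).
Proof.
have ms k : measurable_broadcast (fun x => seen x k).
  by apply: measurable_observed => // t; exact: measurable_noise_broadcast.
have mgap (s s' : dim.-tuple R -> 'rV[R]_r) k j : measurable_vec s -> measurable_vec s' ->
    measurable_fun setT (fun x => (s x - s' x) 0 j / beta k).
  by move=> m m'; apply: measurable_funM => //; exact: (measurable_vecB _ _ m m' j).
rewrite /noise_shift.
have mz k := measurable_replay alpha gamma p p_diff z0 seen k ms.
have mz' k := measurable_replay alpha gamma p' p'_diff z0 seen k ms.
case: (enum_val c) => -[[i k] j]; apply: mgap.
- exact: (mz k).1.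
- exact: (mz' k).1.
- exact: (mz k).2.
- exact: (mz' k).2.
Qed.

End Measurability.

Section Cost.
Variables (b_eta b_xi : R) (i0 : 'I_n).
Hypothesis eqW : weights p = weights p'.
Hypothesis eqf : forall j, j != i0 -> local_obj p j = local_obj p' j.

Definition noise_scale c : R := if enum_val c is inl _ then b_eta else b_xi.

Lemma sum_triples (F : 'I_n -> 'I_K.+1 -> 'I_r -> R) :
  \sum_(q : 'I_n * 'I_K.+1 * 'I_r) F q.1.1 q.1.2 q.2 = \sum_k \sum_i \sum_j F i k j.
Proof. by rewrite [RHS]exchange_big pair_bigA pair_bigA. Qed.

Lemma sum_coordinate_gap (b : R) (k : nat) (s s' : 'I_n -> 'rV[R]_r) :
  (forall i, i != i0 -> s i = s' i) ->
  \sum_i \sum_j `|(s i - s' i) 0 j / beta k| / b = norm1 (s i0 - s' i0) / (beta k * b).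
Proof.
move=> ss'; rewrite (bigD1 i0)//= [X in _ + X]big1 ?addr0.
  rewrite /norm1 mulr_suml; apply: eq_bigr => j _.
  by rewrite normrM normfV (gtr0_norm (beta0 k)) invfM mulrA.
move=> i ii0; rewrite big1// => j _.
by rewrite ss'// subrr mxE mul0r normr0 mul0r.
Qed.

(** All agents but [i0] contribute nothing, and summing over the dimensions turns
absolute values into 1-norms. *)
Lemma cost_gaps x :
  \sum_(c <- noise_order) `|noise_shift c x| / noise_scale c =
  \sum_(k < K.+1)
    (norm1 (tracker_gap alpha gamma p p' i0 z0 (seen x) k) / (beta k * b_eta)
     + norm1 (decision_gap alpha gamma p p' i0 z0 (seen x) k) / (beta k * b_xi)).
Proof.
have e_perm : perm_eq noise_order (index_enum 'I_dim).
  by rewrite /noise_order perm_sort enumT.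
rewrite (perm_big _ e_perm)/= (reindex (@enum_rank _))/=; last first.
  by exists enum_val => c _; [rewrite enum_rankK|rewrite enum_valK].
rewrite big_sumType/= big_split/=; congr (_ + _).
  pose F i (k : 'I_K.+1) j := `|(tracker (replay alpha gamma p z0 (seen x) k) i
    - tracker (shadow x k) i) 0 j / beta k| / b_eta.
  transitivity (\sum_(q : 'I_n * 'I_K.+1 * 'I_r) F q.1.1 q.1.2 q.2).
    by apply: eq_bigr => -[[i k] j] _; rewrite /noise_shift /noise_scale enum_rankK.
  rewrite sum_triples; apply: eq_bigr => k _.
  rewrite sum_coordinate_gap// => i ii0.
  by have [] := replay_unaffected alpha gamma p p' i0 eqW eqf z0 (seen x) i k ii0.
pose F i (k : 'I_K.+1) j := `|(decision (replay alpha gamma p z0 (seen x) k) i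
  - decision (shadow x k) i) 0 j / beta k| / b_xi.
transitivity (\sum_(q : 'I_n * 'I_K.+1 * 'I_r) F q.1.1 q.1.2 q.2).
  by apply: eq_bigr => -[[i k] j] _; rewrite /noise_shift /noise_scale enum_rankK.
rewrite sum_triples; apply: eq_bigr => k _.
rewrite sum_coordinate_gap// => i ii0.
by have [] := replay_unaffected alpha gamma p p' i0 eqW eqf z0 (seen x) i k ii0.
Qed.

End Cost.

End Coupling.

(** * Differential privacy *)

Lemma measurable_norm2_comp {R : realType} {d} {E : measurableType d} {r : nat}
    (u : E -> 'rV[R]_r) : measurable_vec u -> measurable_fun setT (fun x => norm2 (u x)).
Proof.
move=> mu; have msqrt : measurable_fun [set: R] (@Num.sqrt R).
  by apply: continuous_measurable_fun; exact: sqrt_continuous.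
apply: (measurableT_comp msqrt).
by apply: measurable_sum => j; apply: measurable_funX; exact: mu.
Qed.

Theorem theorem2 (R : realType) (d : measure_display) (T : measurableType d)
    (P : probability T R) (n r : nat)
    (X : set 'rV[R]_r) (Sobj : set ('rV[R]_r -> R)) (W : 'M[R]_n) (C : R)
    (alpha : R) (gamma beta : nat -> R) (b_eta b_xi : R)
    (eta xi : 'I_n -> nat -> 'I_r -> {RV P >-> R}) (K : nat) (eps : R)
    (hW : weight_matrix W)
    (hS : forall f, Sobj f -> forall x, differentiable f x)
    (hC : 0 < C)
    (hG : forall f, Sobj f -> forall x, X x -> norm2 (gradient f x) <= C)
    (halpha : 0 < alpha)
    (hgamma : forall k, 0 < gamma k)
    (hbeta : forall k, 0 < beta k)
    (hb_eta : 0 < b_eta) (hb_xi : 0 < b_xi)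
    (heta : forall i k j, laplace_distributed b_eta (eta i k j))
    (hxi : forall i k j, laplace_distributed b_xi (xi i k j))
    (hindep : mutually_independent (joint_noise eta xi))
    (hdom : decisions_in_domain alpha gamma beta eta xi K (problem_class X Sobj W))
    (heps : 0 < eps)
    (hprivacy : forall i : 'I_n,
      2 * Num.sqrt r%:R * C *
        (\sum_(1 <= k < K.+1) \sum_(0 <= t < k)
           (W i i ^+ (k - 1 - t) / (beta k * b_eta)
            + alpha * `|sens_coef (W i i) k t| / (beta k * b_xi)) * gamma t)
      <= eps) :
  differentially_private P (problem_class X Sobj W)
    (alg alpha gamma beta eta xi K) eps.
Proof.
move=> p p' cp cp' [_ eqW [i0 [_ eqf']]] z0 hz0 Y mY.
have [dX wW fS] := cp; have [dX' wW' fS'] := cp'.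
have hz0' : initial_state p' z0 by move=> i; rewrite dX' -dX; exact: hz0.
have eqf j : j != i0 -> local_obj p j = local_obj p' j by exact: eqf'.
have p_diff i v : differentiable (local_obj p i) v by exact: hS.
have p'_diff i v : differentiable (local_obj p' i) v by exact: hS.
pose Z := @noise_coord R d T P n r K eta xi.
pose N := noise_tuple Z.
pose b := @noise_scale R n r K b_eta b_xi.
have b_gt0 c : 0 < b c by rewrite /b /noise_scale; case: (enum_val c).
have Z_laplace c : laplace_distributed (b c) (Z c).
  rewrite /b /noise_scale /Z /noise_coord; case: (enum_val c) => -[[i k] j];
  [exact: heta|exact: hxi].
have Z_indep := noise_coord_indep (K := K) eta xi hindep.
pose h := @noise_shift R n r K alpha gamma beta p p' z0.
pose s := @noise_order n r K.
pose tau w := shear h s (N w).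
have mh c : measurable_fun setT (h c) by exact: measurable_noise_shift.
have h_causal := @noise_shift_causal R n r K alpha gamma beta p p' z0.
have s_uniq : uniq s := @noise_order_uniq n r K.
have s_sorted := @noise_order_sorted n r K.
pose e := @noise_broadcast R n r K.
have me t : measurable_broadcast (e ^~ t) := measurable_noise_broadcast t.
pose obs x := @observation_tuple R n r K (observed alpha gamma beta p' z0 (e x)).
have mB : measurable (obs @^-1` Y).
  have mobs : measurable_fun setT obs.
    by apply: measurable_observation_tuple => k; exact: measurable_observed.
  by rewrite -[X in measurable X]setTI; exact: mobs.
have -> : alg alpha gamma beta eta xi K p' z0 @^-1` Y = N @^-1` (obs @^-1` Y).
  by apply/seteqP; split => w; rewrite /obs /= algE.
have -> : alg alpha gamma beta eta xi K p z0 @^-1` Y = tau @^-1` (obs @^-1` Y).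
  have tauE w : alg alpha gamma beta eta xi K p z0 w = obs (tau w).
    rewrite algE /obs; apply: eq_observation_tuple => k kK.
    by rewrite observed_sheared.
  by apply/seteqP; split => w; rewrite /= tauE.
(* Both probabilities are now those of one event, under the shear of the noise
   and under the noise itself. *)
have privacy := shear_privacy Z b b_gt0 Z_laplace Z_indep (@noise_time n r K) h mh
  h_causal s s_uniq s_sorted.
have null := shear_null Z b b_gt0 Z_laplace Z_indep (@noise_time n r K) h mh
  h_causal s s_uniq s_sorted.
apply: privacy mB _ _.
pose bounded (q : problem R n r) z :=
  norm2 (gradient (local_obj q i0) (decision z i0)) <= C.
have ae_bounded q : problem_class X Sobj W q -> initial_state q z0 ->
    \forall w \ae P, forall t : 'I_K, bounded q (run alpha gamma beta q z0 (e (N w)) t).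
  move=> cq hq; apply: filter_forall => t.
  have [dq _ fq] := cq.
  apply: filterS (hdom q cq z0 hq i0 t (ltn_ord t)) => w.
  rewrite dq (iterate_run (K := K)); last by rewrite ltnW// ltnS ltnW.
  by apply: hG.
(* The bound along the run on [tau w] is transported from the run on [N w]. *)
have good' : \forall w \ae P, forall t : 'I_K,
    bounded p' (run alpha gamma beta p' z0 (e (tau w)) t).
  pose good_t (t : 'I_K) := [set x | bounded p' (run alpha gamma beta p' z0 (e x) t)].
  have mgood t : measurable (good_t t).
    have mn : measurable_fun setT (fun x => norm2 (gradient (local_obj p' i0)
         (decision (run alpha gamma beta p' z0 (e x) t) i0))).
      apply: measurable_norm2_comp; apply: measurable_gradient_comp; first exact: p'_diff.
      exact: (measurable_run alpha gamma beta p' p'_diff z0 e t me).2.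
    have := mn measurableT `]-oo, C]%classic (measurable_itv _).
    by rewrite setTI set_itvE.
  have good_null t : P (N @^-1` (~` good_t t)) = 0%E.
    apply: measure_negligible.
      rewrite -[X in measurable X]setTI; apply: measurable_noise_tuple => //.
      exact: measurableC.
    apply: negligibleS (ae_bounded p' cp' hz0') => w /= bad all_good.
    exact/bad/all_good.
  apply: filter_forall => t.
  have mbad : measurable (~` good_t t) by exact: measurableC.
  exists (tau @^-1` (~` good_t t)); split => //; last exact: null.
  rewrite -[X in measurable X]setTI; apply: (measurableT_comp (f := shear h s)) => //.
    exact: measurable_shear.
  exact: measurable_noise_tuple.
apply: filterS2 (ae_bounded p cp hz0) good' => w good_w good'_w.
rewrite (cost_gaps alpha gamma beta p p' z0 hbeta b_eta b_xi i0 eqW eqf).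
apply: le_trans (hprivacy i0).
rewrite -wW; apply: sum_norm1_gaps_le => //.
- move=> t tK; have := good_w (Ordinal tK); by rewrite /bounded run_replay.
- move=> t tK; have := good'_w (Ordinal tK).
  by rewrite /bounded run_sheared//= ltnW.
- by rewrite wW; exact: weight_diag_gt0.
Qed.
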